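(* For $i,j\in\{0,1,2\}$ let $f_{ij}:\mathbb{Q}\to\mathbb{Q}$ be defined by $$f_{ij}(x,y,t) := \left(\frac{x+i}{3},\frac{y+j}{3},t\right),\qquad (x,y,t)\in\mathbb{Q}.$$ Then the split carpet $\mathbb{SC}$ is a strict attractor with full basin of the iterated function system $\mathcal{F}=(\mathbb{Q}; f_{ij} : (i,j)\in\{0,1,2\}^2\setminus\{(1,1)\})$.
   Context: The split square is the set $$\mathbb{Q} = \big([0,1)\times(0,1]\times\{1\}\big)\cup\big((0,1]\times(0,1]\times\{2\}\big)\cup\big((0,1]\times[0,1)\times\{3\}\big)\cup\big([0,1)\times[0,1)\times\{4\}\big)$$ (here $\mathbb{Q}$ does not denote the rationals), endowed with the topology generated by the basis consisting of the sets $$Q(a,b;c,d) := \big([a,b)\times(c,d]\times\{1\}\big)\cup\big((a,b]\times(c,d]\times\{2\}\big)\cup\big((a,b]\times[c,d)\times\{3\}\big)\cup\big([a,b)\times[c,d)\times\{4\}\big),$$ for $0\le a<b\le 1$, $0\le c<d\le 1$. The split carpet is $\mathbb{SC}:=\bigcap_{k} SC_k$ (over all integers $k\ge 0$), where $SC_0:=Q(0,1;0,1)=\mathbb{Q}$ and, for $k\ge 1$, $$SC_k := SC_{k-1}\setminus\bigcup_{0\le l,m<3^{k-1}} Q\left(\frac{3l+1}{3^k},\frac{3l+2}{3^k};\frac{3m+1}{3^k},\frac{3m+2}{3^k}\right),$$ with $l,m$ integers. An iterated function system (IFS) $\mathcal{F}=(X; f_i : i\in I)$ is a finite collection of continuous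 maps $f_i:X\to X$, $i\in I$, on a Hausdorff topological space $X$. $\mathcal{K}(X)$ denotes the set of nonempty compact subsets of $X$ with the Vietoris topology, whose subbasic open sets are $V^{+}=\{S\in\mathcal{K}(X): S\subseteq V\}$ and $V^{-}=\{S\in\mathcal{K}(X): S\cap V\neq\emptyset\}$, $V$ running over all open sets in $X$. The Hutchinson operator of $\mathcal{F}$ is $F:\mathcal{K}(X)\to\mathcal{K}(X)$, $F(K)=\bigcup_{i\in I} f_i(K)$, and $F^n$ is its $n$-fold composition. A set $A\in\mathcal{K}(X)$ is a strict attractor of $\mathcal{F}$ if there exists an open set $U\supseteq A$ such that $F^n(K)\to A$ as $n\to\infty$ in the Vietoris topology for every $K\in\mathcal{K}(U)$ (nonempty compact $K\subseteq U$). It has full basin if one can take $U=X$. *)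

(* Defs.v *)
From HB Require Import structures.
From mathcomp Require Import all_boot all_order all_algebra.
From mathcomp Require Import lra.
From mathcomp Require Import boolp classical_sets functions.
From mathcomp Require Import reals topology normedtype.
Set Implicit Arguments.
Unset Strict Implicit.
Unset Printing Implicit Defensive.
Import Order.TTheory GRing.Theory Num.Theory.
Import numFieldNormedType.Exports.
Local Open Scope classical_set_scope.
Local Open Scope ring_scope.

(* Q(a,b;c,d), as a subset of R x R x nat; the third coordinate is the label
   1, 2, 3 or 4. *)
Definition Qset (R : realType) (a b c d : R) : set (R * R * nat) :=
  ([set` `[a, b[] `*` [set` `]c, d]] `*` [set 1%N]) `|`
  ([set` `]a, b]] `*` [set` `]c, d]] `*` [set 2%N]) `|`
  ([set` `]a, b]] `*` [set` `[c, d[] `*` [set 3%N]) `|`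
  ([set` `[a, b[] `*` [set` `[c, d[] `*` [set 4%N]).

Record splitSquare (R : realType) := SplitSquare {
  split_val : R * R * nat ;
  split_valP : split_val \in Qset 0 1 0 1 }.

HB.instance Definition _ (R : realType) := [isSub for @split_val R].
HB.instance Definition _ (R : realType) := [Choice of splitSquare R by <:].

(* Q(a,b;c,d), as a subset of the split square. *)
Definition Qbox (R : realType) (a b c d : R) : set (splitSquare R) :=
  [set p | Qset a b c d (split_val p)].

Section Half.
Variable R : realType.
Implicit Types (a b c d x y : R) (s : bool) (t : nat).

Definition half s a b x := if s then a <= x < b else a < x <= b.
Definition xright t := (t == 1%N) || (t == 4).
Definition yright t := (t == 3) || (t == 4).

Lemma QsetE a b c d x y t : Qset a b c d (x, y, t) <->
  [/\ 0 < t <= 4, half (xright t) a b x & half (yright t) c d y]%N.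
Proof.
rewrite /Qset /=; split.
  by move=> [[[]|]|] [[/=]]; rewrite !in_itv /= => ? ? ->.
case: t => [|[|[|[|[|t]]]]] [] //= _; rewrite /half /= => hx hy.
- by left; left; left; rewrite /= !in_itv /= hx hy.
- by left; left; right; rewrite /= !in_itv /= hx hy.
- by left; right; rewrite /= !in_itv /= hx hy.
- by right; rewrite /= !in_itv /= hx hy.
Qed.

Lemma half_ne s a b x : half s a b x -> a < b.
Proof. by case: s => /andP[]; [exact: le_lt_trans|exact: lt_le_trans]. Qed.

Lemma halfI s a b a' b' x :
  half s (Num.max a a') (Num.min b b') x <-> half s a b x /\ half s a' b' x.
Proof.
rewrite /half; case: s.
  rewrite ge_max lt_min; split; first by case/andP=> /andP[-> ->] /andP[-> ->].
  by case=> /andP[-> ->] /andP[-> ->].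
rewrite gt_max le_min; split; first by case/andP=> /andP[-> ->] /andP[-> ->].
by case=> /andP[-> ->] /andP[-> ->].
Qed.

Lemma half_aff s a b (i x : R) :
  half s a b ((x + i) / 3) <-> half s (3 * a - i) (3 * b - i) x.
Proof.
by rewrite /half; case: s; split => /andP[h1 h2]; apply/andP; split; lra.
Qed.

Lemma half_shrink s (i x : R) : 0 <= i <= 2 -> half s 0 1 x ->
  half s 0 1 ((x + i) / 3).
Proof.
rewrite /half => /andP[i0 i2]; case: s => /andP[h1 h2].
  by apply/andP; split; lra.
by apply/andP; split; lra.
Qed.

Lemma half_sep s s' x x' : half s 0 1 x -> half s' 0 1 x' ->
  (x != x') || (s != s') ->
  exists m, [/\ 0 < m < 1 &
    (half s 0 m x /\ half s' m 1 x') \/ (half s m 1 x /\ half s' 0 m x')].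
Proof.
move=> hx hx' ne; case: (ltgtP x x') => xx'.
- exists ((x + x') / 2); move: hx hx'; rewrite /half => {ne}.
  by case: s; case: s' => /andP[h1 h2] /andP[h3 h4]; split; try left;
    try split; apply/andP; split; lra.
- exists ((x + x') / 2); move: hx hx'; rewrite /half => {ne}.
  by case: s; case: s' => /andP[h1 h2] /andP[h3 h4]; split; try right;
    try split; apply/andP; split; lra.
- move: ne; rewrite xx' eqxx /= => ne; subst x'; exists x.
  move: hx hx' ne; rewrite /half.
  case: s; case: s' => // /andP[h1 h2] /andP[h3 h4] _; split.
  + by apply/andP; split; lra.
  + by right; split; apply/andP; split; lra.
  + by apply/andP; split; lra.
  + by left; split; apply/andP; split; lra.
Qed.

Lemma half_disj s a b a' b' x : half s a b x -> half s a' b' x ->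
  b <= a' -> False.
Proof. by rewrite /half; case: s => /andP[? ?] /andP[? ?] ?; lra. Qed.

Lemma split_valE (p : splitSquare R) : Qset 0 1 0 1 (split_val p).
Proof. by have := split_valP p; rewrite inE. Qed.

Definition Q_index : set (R * R * (R * R)) :=
  [set i | [/\ 0 <= i.1.1, i.1.1 < i.1.2 & i.1.2 <= 1] /\
           [/\ 0 <= i.2.1, i.2.1 < i.2.2 & i.2.2 <= 1]].

Definition Q_base (i : R * R * (R * R)) : set (splitSquare R) :=
  Qbox i.1.1 i.1.2 i.2.1 i.2.2.

Lemma Q_base_cover : \bigcup_(i in Q_index) Q_base i = setT.
Proof.
apply/seteqP; split=> // p _; exists (0, 1, (0, 1)); last exact: split_valE.
by rewrite /Q_index /=; split; split; lra.
Qed.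

Lemma Q_base_join i j p : Q_index i -> Q_index j -> Q_base i p -> Q_base j p ->
  exists k, [/\ Q_index k, Q_base k p & Q_base k `<=` Q_base i `&` Q_base j].
Proof.
move: i j => [[a b] [c d]] [[a' b'] [c' d']].
rewrite /Q_index /Q_base /Qbox /=.
move=> [[a0 ab b1] [c0 cd d1]] [[a'0 ab' b'1] [c'0 cd' d'1]].
case: p => -[[x y] t] /= pP /QsetE[t4 hx hy] /QsetE[_ hx' hy'].
exists (Num.max a a', Num.min b b', (Num.max c c', Num.min d d')); split => /=.
- split; split.
  + by rewrite le_max a0.
  + by apply: (@half_ne (xright t) _ _ x); apply/halfI.
  + by rewrite ge_min b1.
  + by rewrite le_max c0.
  + by apply: (@half_ne (yright t) _ _ y); apply/halfI.
  + by rewrite ge_min d1.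
- by apply/QsetE; split=> //; apply/halfI.
- case=> -[[u v] w] /= _ /QsetE[w4 /halfI[h1 h2] /halfI[h3 h4]].
  by split; apply/QsetE.
Qed.

HB.instance Definition _ :=
  @isBaseTopological.Build (splitSquare R) (R * R * (R * R))%type
    Q_index Q_base Q_base_cover Q_base_join.

Lemma Qbox_open a b c d : 0 <= a -> a < b -> b <= 1 ->
  0 <= c -> c < d -> d <= 1 -> open (Qbox a b c d).
Proof.
move=> *; exists [set (a, b, (c, d))]; last by rewrite bigcup_set1.
by move=> _ ->.
Qed.

Lemma nbhs_Qbox (p : splitSquare R) (A : set (splitSquare R)) : nbhs p A ->
  exists i, [/\ Q_index i, Q_base i p & Q_base i `<=` A].
Proof.
rewrite nbhsE => -[B [[D sD <-] [i Di pi]] BA].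
by exists i; split=> //; [exact: sD|move=> q qi; apply: BA; exists i].
Qed.

Lemma splitSquare_hausdorff : hausdorff_space (splitSquare R).
Proof.
rewrite open_hausdorff => -[[[x y] t] pP] [[[x' y'] t'] qP] ne.
have /QsetE[t4 hx hy] := split_valE (SplitSquare pP).
have /QsetE[t4' hx' hy'] := split_valE (SplitSquare qP).
have : ((x != x') || (xright t != xright t')) ||
       ((y != y') || (yright t != yright t')).
  apply: contraNT ne; rewrite !negb_or !negbK.
  move=> /andP[/andP[/eqP xx /eqP tt] /andP[/eqP yy /eqP uu]].
  rewrite -val_eqE /= xx yy xpair_eqE eqxx /=.
  move: t4 t4' tt uu {pP qP hx hy hx' hy'}.
  by case: t => [|[|[|[|[|?]]]]] //; case: t' => [|[|[|[|[|?]]]]].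
have disj (A B : set (splitSquare R)) :
    A `&` B `<=` set0 -> A `&` B == set0.
  by move=> AB; apply/eqP/seteqP; split.
case/orP=> [/(half_sep hx hx')|/(half_sep hy hy')] [m [/andP[m0 m1]]].
- case=> -[h h']; [exists (Qbox 0 m 0 1, Qbox m 1 0 1)|
                   exists (Qbox m 1 0 1, Qbox 0 m 0 1)] => /=.
  + by rewrite !inE; split; apply/QsetE.
  + split; [by apply: Qbox_open => //; exact: ltW|
            by apply: Qbox_open => //; exact: ltW|].
    apply: disj => -[[[u v] w] /= _] [/QsetE[_ a _] /QsetE[_ b _]].
    by apply: half_disj a b _.
  + by rewrite !inE; split; apply/QsetE.
  + split; [by apply: Qbox_open => //; exact: ltW|
            by apply: Qbox_open => //; exact: ltW|].
    apply: disj => -[[[u v] w] /= _] [/QsetE[_ a _] /QsetE[_ b _]].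
    by apply: half_disj b a _.
- case=> -[h h']; [exists (Qbox 0 1 0 m, Qbox 0 1 m 1)|
                   exists (Qbox 0 1 m 1, Qbox 0 1 0 m)] => /=.
  + by rewrite !inE; split; apply/QsetE.
  + split; [by apply: Qbox_open => //; exact: ltW|
            by apply: Qbox_open => //; exact: ltW|].
    apply: disj => -[[[u v] w] /= _] [/QsetE[_ _ a] /QsetE[_ _ b]].
    by apply: half_disj a b _.
  + by rewrite !inE; split; apply/QsetE.
  + split; [by apply: Qbox_open => //; exact: ltW|
            by apply: Qbox_open => //; exact: ltW|].
    apply: disj => -[[[u v] w] /= _] [/QsetE[_ _ a] /QsetE[_ _ b]].
    by apply: half_disj b a _.
Qed.

End Half.

Fixpoint SCstage (R : realType) (k : nat) : set (splitSquare R) :=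
  if k is k'.+1 then
    @SCstage R k' `\`
      \bigcup_(l in `I_(3 ^ k')) \bigcup_(m in `I_(3 ^ k'))
        Qbox ((3 * l + 1)%N%:R / 3 ^+ k) ((3 * l + 2)%N%:R / 3 ^+ k)
             ((3 * m + 1)%N%:R / 3 ^+ k) ((3 * m + 2)%N%:R / 3 ^+ k)
  else Qbox 0 1 0 1.

Arguments SCstage R k : clear implicits.

Definition splitCarpet (R : realType) : set (splitSquare R) :=
  \bigcap_k SCstage R k.

Arguments splitCarpet R : clear implicits.

Record hyperspace (X : topologicalType) := Hyperspace {
  hset :> set X ;
  hset_neq0 : hset !=set0 ;
  hset_compact : compact hset }.

HB.instance Definition _ (X : topologicalType) := gen_eqMixin (hyperspace X).
HB.instance Definition _ (X : topologicalType) :=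
  gen_choiceMixin (hyperspace X).

(* (true, V) indexes V^+ and (false, V) indexes V^-. *)
Definition vietoris_subbase (X : topologicalType) (i : bool * set X) :
    set (hyperspace X) :=
  if i.1 then [set S : hyperspace X | S `<=` i.2]
  else [set S : hyperspace X | (S : set X) `&` i.2 !=set0].

HB.instance Definition _ (X : topologicalType) :=
  isSubBaseTopological.Build (hyperspace X)
    [set i : bool * set X | open i.2] (@vietoris_subbase X).

(* A nonempty index set is needed for the Hutchinson operator to map nonempty
   sets to nonempty sets. *)
Record ifs (X : topologicalType) (I : finType) := IFS {
  ifs_map :> I -> X -> X ;
  ifs_hausdorff : hausdorff_space X ;
  ifs_continuous : forall i, continuous (ifs_map i) ;
  ifs_nonempty : (0 < #|I|)%N }.

Section Hutchinson.
Variables (X : topologicalType) (I : finType) (F : ifs X I).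
Implicit Type K : hyperspace X.

Definition hutchinson_set (S : set X) : set X := \bigcup_i (F i @` S).

Lemma hutchinson_neq0 K : hutchinson_set K !=set0.
Proof.
have [i _] : exists i : I, i \in I by apply/card_gt0P; exact: ifs_nonempty F.
have [x Kx] := hset_neq0 K.
by exists (F i x), i => //; exists x.
Qed.

Lemma hutchinson_compact K : compact (hutchinson_set K).
Proof.
have -> : hutchinson_set K = \big[setU/set0]_(i : I) (F i @` K).
  rewrite -(bigcup_pred xpredT); congr bigcup.
  by apply/seteqP; split.
apply: bigsetU_compact => i _; apply: continuous_compact;
  last exact: hset_compact.
exact/continuous_subspaceT/ifs_continuous.
Qed.

Definition hutchinson K : hyperspace X :=
  Hyperspace (hutchinson_neq0 K) (@hutchinson_compact K).

Definition attracts (A : hyperspace X) (U : set X) :=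
  [/\ open U, (A : set X) `<=` U &
      forall K, (K : set X) `<=` U -> iter n hutchinson K @[n --> \oo] --> A].

Definition strict_attractor (A : set X) :=
  exists2 A' : hyperspace X, A' = A :> set X & exists U, attracts A' U.

Definition full_basin (A : set X) :=
  exists2 A' : hyperspace X, A' = A :> set X & attracts A' setT.

End Hutchinson.

Section CarpetIFS.
Variable R : realType.

Lemma carpet_map_subproof (i j : 'I_3) (p : splitSquare R) :
  (((split_val p).1.1 + i%:R) / 3, ((split_val p).1.2 + j%:R) / 3,
    (split_val p).2) \in @Qset R 0 1 0 1.
Proof.
have h3 (k : 'I_3) : 0 <= (k%:R : R) <= 2.
  by rewrite ler0n ler_nat -ltnS ltn_ord.
rewrite inE; have := split_valE p; case: p => -[[x y] t] /= _ /QsetE[t4 hx hy].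
by apply/QsetE; split=> //; exact: half_shrink.
Qed.

Definition carpet_map (i j : 'I_3) (p : splitSquare R) : splitSquare R :=
  SplitSquare (carpet_map_subproof i j p).

Lemma carpet_map_continuous i j : continuous (carpet_map i j).
Proof.
move=> p A /nbhs_Qbox[[[a b] [c d]] []].
rewrite /Q_index /Q_base /= => -[[a0 ab b1] [c0 cd d1]] fp QA.
rewrite nbhsE /=; pose r k : R := 3 * k - i%:R; pose s k : R := 3 * k - j%:R.
exists (Qbox (Num.max 0 (r a)) (Num.min 1 (r b))
             (Num.max 0 (s c)) (Num.min 1 (s d))); last first.
  case=> -[[x y] t] qP /QsetE[t4 /halfI[_ hx] /halfI[_ hy]]; apply: QA.
  by apply/QsetE; split=> //; apply/half_aff.
have := split_valE p; case: p fp => -[[x y] t] pP fp /= /QsetE[t4 hx hy].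
have /QsetE[_ /half_aff hx' /half_aff hy'] := fp.
have kx : half (xright t) (Num.max 0 (r a)) (Num.min 1 (r b)) x by apply/halfI.
have ky : half (yright t) (Num.max 0 (s c)) (Num.min 1 (s d)) y by apply/halfI.
split; last by apply/QsetE.
apply: Qbox_open; rewrite ?le_max ?ge_min ?lexx //.
- exact: half_ne kx.
- exact: half_ne ky.
Qed.

Definition carpet_index := {ij : 'I_3 * 'I_3 | ij != (1, 1)}.

Lemma carpet_index_gt0 : (0 < #|{: carpet_index}|)%N.
Proof.
have h : (0, 0) != (1, 1) :> 'I_3 * 'I_3 by [].
by apply/card_gt0P; exists (Sub (0, 0) h).
Qed.

Definition carpet_ifs : ifs (splitSquare R) carpet_index :=
  @IFS (splitSquare R) carpet_index
    (fun ij => carpet_map (val ij).1 (val ij).2)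
    (@splitSquare_hausdorff R)
    (fun ij => @carpet_map_continuous (val ij).1 (val ij).2)
    carpet_index_gt0.

End CarpetIFS.

(* Main.v *)
(* A box f_w(Q) is again a basic clopen box, so F^n(Q) is the n-th stage SC_n of
   the carpet.  Since Q is compact, an open V containing the carpet contains
   some SC_n, hence F^n(K) for all large n and all K.  For the other half of
   Vietoris convergence, let p be in the carpet and in a basic open box V.  The
   cells f_w(Q) containing p need not lie in V, however small: they may stick
   out on the side where V has p on its boundary.  But the subcell at the corner
   of f_w(Q) pointing away from that side is obtained by iterating one of the
   four corner maps, which belong to the system, and it does lie in V.
   Compactness of Q follows by taking an ultrafilter and cutting each coordinate
   at the supremum of the m for which the half of Q beyond m is large. *)
From Pilot Require (* Restores [Defs.half], shadowed by [ssrnat.half]. *)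
Import Defs.
From mathcomp Require Import all_boot all_order all_algebra.
From mathcomp Require Import ring lra zify.
From mathcomp Require Import boolp classical_sets functions.
From mathcomp Require Import reals topology normedtype.
Set Implicit Arguments.
Unset Strict Implicit.
Unset Printing Implicit Defensive.
Import Order.TTheory GRing.Theory Num.Theory.
Import numFieldNormedType.Exports.
Import Defs.
Local Open Scope classical_set_scope.
Local Open Scope ring_scope.

(** * Vietoris limits, and decreasing closed sets in a compact space *)

Lemma vietoris_cvg (X : topologicalType) (u : nat -> hyperspace X)
    (A : hyperspace X) :
    (forall V, open V -> (A : set X) `<=` V ->
      \forall n \near \oo, (u n : set X) `<=` V) ->
    (forall V, open V -> (A : set X) `&` V !=set0 ->
      \forall n \near \oo, (u n : set X) `&` V !=set0) ->
  u n @[n --> \oo] --> A.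
Proof.
move=> upper lower W; rewrite nbhsE => -[B [[D sD <-] [E DE AE]] BW].
suff: \forall n \near \oo, E (u n).
  by apply: filterS => n En; apply: BW; exists E.
have [D' D'sub EE] := sD _ DE; move: AE; rewrite -EE => AE.
(* A basic neighbourhood is a finite intersection of subbasic sets, so the eventual conditions
   combine. *)
apply: filter_bigI => -[sgn V] iD'; have := AE _ iD'.
have := D'sub _ iD'; rewrite inE /= => oV.
by rewrite /vietoris_subbase; case: sgn {iD'} => /=; [exact: upper|exact: lower].
Qed.

(** Otherwise the differences of [C n] and [V] form the base of a proper filter; a cluster point
    lies in every [C n] but outside [V]. *)
Lemma compact_bigcap_sub_open (X : topologicalType) (C : nat -> set X)
    (V : set X) : compact [set: X] -> (forall n, closed (C n)) ->
  {homo C : m n / (m <= n)%N >-> n `<=` m} -> open V -> \bigcap_n C n `<=` V ->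
  exists n, C n `<=` V.
Proof.
move=> cX clC decC oV CV; apply: contrapT => nV.
have ne n : C n `\` V !=set0.
  apply: contrapT => /nonemptyPn e; apply: nV; exists n => x Cx.
  by apply: contrapT => nVx; have : (C n `\` V) x by []; rewrite e.
pose F := filter_from [set: nat] (fun n => C n `\` V).
have FF : ProperFilter F.
  apply: filter_from_proper => [|n _]; last exact: ne.
  apply: filter_from_filter; first by exists 0%N.
  move=> m n _ _; exists (maxn m n) => // x [Cx nVx].
  by split; split=> //; apply: decC Cx; rewrite ?leq_maxl ?leq_maxr.
have FD n : F (C n `\` V) by exists n.
have [p [_ clp]] := cX F FF (@filterT _ F _).
have pD n : (C n `\` V) p.
  have clD : closed (C n `\` V) by apply: closedI => //; exact: open_closedC.
  by apply: clD => B Bp; exact: clp.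
by have [_] := pD 0%N; apply; apply: CV => n _; case: (pD n).
Qed.

(** * Iterates of the Hutchinson operator on plain sets *)

Section Hutchinson.
Variables (X : topologicalType) (I : finType) (F : ifs X I).
Local Notation FS := (hutchinson_set F).

Lemma iter_hutchinsonE n (K : hyperspace X) :
  iter n (hutchinson F) K = iter n FS K :> set X.
Proof. by elim: n => //= n ->. Qed.

Lemma iter_hutchinson_set_sub n (S S' : set X) : S `<=` S' ->
  iter n FS S `<=` iter n FS S'.
Proof.
elim: n => //= n IH SS' _ [i _ [x Sx <-]].
by exists i => //; exists x => //; exact: IH.
Qed.

Lemma full_basin_strict_attractor (A : set X) :
  full_basin F A -> strict_attractor F A.
Proof. by case=> A' AA' h; exists A' => //; exists setT. Qed.

End Hutchinson.

(** * One coordinate: sided intervals and ternary digits *)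

Section Half.
Variable R : realType.
Implicit Types (a b x y u v : R) (s : bool).

Lemma half_sub s a b a' b' x : a' <= a -> b <= b' -> half s a b x ->
  half s a' b' x.
Proof.
by rewrite /half; case: s => ? ? /andP[? ?]; apply/andP; split; lra.
Qed.

Lemma half_cut s m x : half s 0 1 x -> half s 0 m x \/ half s m 1 x.
Proof.
rewrite /half; case: s => /andP[-> ->] /=; rewrite ?andbT.
  by case: (leP m x) => _; [right|left].
by case: (leP x m) => _; [left|right].
Qed.

(** The limit is [sup S]. If [S] contains its supremum, [F] lives on the upper side of it and the
    limit has side [true]; otherwise [F] lives on the lower side and the limit has side [false]. *)
Lemma ultra_half_cvg (T : Type) (F : set_system T) (s : T -> bool) (x : T -> R) :
    UltraFilter F -> (forall t, half (s t) 0 1 (x t)) ->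
  exists s0 x0, half s0 0 1 x0 /\ forall a b, 0 <= a -> b <= 1 ->
    half s0 a b x0 -> F [set t | half (s t) a b (x t)].
Proof.
move=> FU hx.
pose G a b := [set t | half (s t) a b (x t)].
have GS a b a' b' : a' <= a -> b <= b' -> F (G a b) -> F (G a' b').
  by move=> aa bb; apply: filterS => t; exact: half_sub.
have GI a b : F (G a 1) -> F (G 0 b) -> F (G a b).
  move=> Fa Fb; apply: filterS (filterI Fa Fb) => t []; rewrite /G /half /=.
  by case: (s t) => /andP[h1 h2] /andP[h3 h4]; apply/andP; split.
pose S := [set m : R | 0 <= m <= 1 /\ F (G m 1)].
have NS m : 0 <= m <= 1 -> ~ S m -> F (G 0 m).
  move=> m01 nS; have [FG|] := in_ultra_setVsetC (G m 1) FU.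
    by case: nS.
  by apply: filterS => t /= nh; have [|/nh] := half_cut m (hx t).
have S0 : S 0.
  split; first by lra.
  by apply: filterS (@filterT _ F _) => t _; exact: hx.
have NS1 : ~ S 1.
  case=> _ F1; have [t /=] := filter_ex F1.
  by rewrite /G /half /=; case: (s t) => /andP[? ?]; lra.
have ubS : ubound S 1 by move=> m [/andP[_ ?] _].
have hubS : has_ubound S by exists 1.
have sup0 : 0 <= sup S by exact: (ub_le_sup hubS).
have sup1 : sup S <= 1 by apply: ge_sup => //; exists 0.
have [Ssup|nSsup] := pselect (S (sup S)).
  have sup_lt1 : sup S < 1.
    by rewrite lt_neqAle sup1 andbT; apply/eqP => e; apply: NS1; rewrite -e.
  exists true, (sup S); split=> [|a b a0 b1 /andP[ax xb]].
    by apply/andP; split.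
  apply: GI; first by apply: GS Ssup.2.
  apply: NS; first by apply/andP; split; lra.
  by move=> /(ub_le_sup hubS); rewrite leNgt xb.
have sup_gt0 : 0 < sup S.
  by rewrite lt_neqAle sup0 andbT; apply/eqP => e; apply: nSsup; rewrite -e.
exists false, (sup S); split=> [|a b a0 b1 /andP[ax xb]].
  by apply/andP; split.
apply: GI.
  have [|m [_ Fm] am] := sup_gt _ ax; first by exists 0.
  by apply: GS Fm => //; exact: ltW.
apply: NS; first by apply/andP; split; lra.
move=> Sb; have := ub_le_sup hubS Sb => bx.
by apply: nSsup; have -> : sup S = b by apply/eqP; rewrite eq_le bx xb.
Qed.

(** The first ternary digit; at the ties 1/3 and 2/3 the side decides. *)
Lemma half_digit s x : half s 0 1 x ->
  exists i : 'I_3, half s 0 1 (3 * x - i%:R).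
Proof.
have i0 : ((@inord 2 0 : 'I_3)%:R = 0 :> R) by rewrite inordK.
have i1 : ((@inord 2 1 : 'I_3)%:R = 1 :> R) by rewrite inordK.
have i2 : ((@inord 2 2 : 'I_3)%:R = 2%:R :> R) by rewrite inordK.
rewrite /half; case: s => /andP[x0 x1].
  case: (ltP x (1 / 3)) => h1; first by exists (inord 0); rewrite i0; lra.
  case: (ltP x (2 / 3)) => h2; first by exists (inord 1); rewrite i1; lra.
  by exists (inord 2); rewrite i2; lra.
case: (leP x (1 / 3)) => h1; first by exists (inord 0); rewrite i0; lra.
case: (leP x (2 / 3)) => h2; first by exists (inord 1); rewrite i1; lra.
by exists (inord 2); rewrite i2; lra.
Qed.

(** One-coordinate shadow of the holes cut at stage [k.+1]: the ternary digit number [k], counted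
    from 0, is 1. *)
Definition middle k s x := exists2 l, (l < 3 ^ k)%N &
  half s ((3 * l + 1)%N%:R / 3 ^+ k.+1) ((3 * l + 2)%N%:R / 3 ^+ k.+1) x.

Lemma middle0 s (i : 'I_3) x : half s 0 1 x ->
  middle 0 s ((x + i%:R) / 3) <-> i = 1.
Proof.
have i1 : (i = 1) <-> (i = 1%N :> nat) by split=> [->//|e]; apply: val_inj; rewrite /= e.
move=> hx; rewrite i1 /middle.
split=> [[l]|e]; last first.
  exists 0%N => //; apply/half_aff; rewrite e; move: hx.
  by apply: half_sub; rewrite ?muln0 ?add0n expr1; lra.
case: l => // _ /half_aff; rewrite muln0 !add0n expr1.
move: hx; case: i {i1} => -[|[|[|n]]] //= ?; rewrite /half;
  by case: s => /andP[? ?] /andP[? ?]; exfalso; lra.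
Qed.

(** Passing to the third number [i] shifts the digits by one: index [l] becomes [l + i * 3 ^ k]. *)
Lemma middleS k s (i : 'I_3) x : half s 0 1 x ->
  middle k.+1 s ((x + i%:R) / 3) <-> middle k s x.
Proof.
move=> hx; pose M := (3 ^ k)%N.
have M0 : 0 < M%:R :> R by rewrite ltr0n expn_gt0.
have ME : 3 ^+ k = M%:R :> R by rewrite natrX.
have shift (l c : nat) : 3 * ((3 * (l + i * M) + c)%N%:R / 3 ^+ k.+2) - i%:R
    = (3 * l + c)%N%:R / 3 ^+ k.+1 :> R.
  rewrite !exprS ME !(natrD, natrM); field.
  by rewrite gt_eqF.
split=> [[l lM /half_aff h]|[l lM h]]; last first.
  exists (l + i * M)%N; last by apply/half_aff; rewrite !shift.
  by have := ltn_ord i; rewrite expnS -/M; move: lM; rewrite -/M; nia.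
(* The point lies in the third number [i], which confines [l] to the [M] indices starting at
   [i * M]. *)
have [lo hi] : (i * M < l.+1 /\ l < i.+1 * M)%N.
  have toM (c : nat) : 3 * ((3 * l + c)%N%:R / 3 ^+ k.+2) =
      (3 * l + c)%N%:R / (3 * M)%N%:R :> R.
    rewrite !exprS ME !(natrD, natrM); field.
    by rewrite gt_eqF.
  have [h1 h2] : i%:R < (3 * l + 2)%N%:R / (3 * M)%N%:R :> R /\
      (3 * l + 1)%N%:R / (3 * M)%N%:R < i%:R + 1 :> R.
    rewrite -!toM; move: hx h; rewrite /half.
    by case: s => /andP[? ?] /andP[? ?]; split; lra.
  move: h1 h2; rewrite ltr_pdivlMr ?ltr_pdivrMr ?ltr0n ?muln_gt0 ?expn_gt0 //.
  rewrite natr1 -!natrM !ltr_nat.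
  by rewrite !(mulnCA _ 3); move: (i * M)%N (i.+1 * M)%N; lia.
exists (l - i * M)%N; first by rewrite -/M; nia.
by rewrite -!shift subnK // -ltnS.
Qed.

Lemma exists_pow3_ge (e : R) : 0 < e ->
  exists N, forall n, (N <= n)%N -> 1 <= 3 ^+ n * e.
Proof.
move=> e0; exists (Num.bound e^-1) => n /upper_nthrootP h.
rewrite -ler_pdivrMr // div1r; apply: ltW (lt_le_trans h _).
by rewrite lerXn2r ?nnegrE ?ler_nat.
Qed.

Lemma half_scale s k c a b x : 0 < k ->
  half s (k * a - c) (k * b - c) (k * x - c) = half s a b x.
Proof.
by move=> k0; rewrite /half !lerBlDr !ltrBlDr !subrK !ler_pM2l ?ltr_pM2l.
Qed.

(* The point x lies in a triadic cell of level m, at relative position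
   3 ^+ m * x - al, and y lies in the subcell of level n + m at the end of that
   cell towards which half-open intervals with orientation s extend. *)
Lemma half_corner s a b x : half s a b x -> exists M, forall m, (M <= m)%N ->
  forall al, half s 0 1 (3 ^+ m * x - al) ->
  exists N, forall n, (N <= n)%N -> forall s' v w y, half s' 0 1 v ->
    3 ^+ n * w = v + (if s then 3 ^+ n - 1 else 0) -> 3 ^+ m * y = w + al ->
    half s' a b y.
Proof.
have pow_gt0 m : 0 < 3 ^+ m :> R by rewrite exprn_gt0.
case: s => /andP[ax xb].
  (* From level [M] on, the cell cannot reach past [b], though it may begin before [a]. *)
  have /exists_pow3_ge[M hM] : 0 < b - x by rewrite subr_gt0.
  exists M => m /hM {}hM al /andP[u0 u1].
  have am : 3 ^+ m * a <= 3 ^+ m * x by rewrite ler_pM2l.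
  (* The right end of the cell lies strictly beyond [a], so a thin enough subcell there starts at or
     after [a]. *)
  have /exists_pow3_ge[N hN] : 0 < 1 - (3 ^+ m * a - al) by lra.
  exists N => n /hN {}hN s' v w y hv wE yE.
  have -> : half s' a b y = half s' (3 ^+ n * (3 ^+ m * a - al))
      (3 ^+ n * (3 ^+ m * b - al)) (v + (3 ^+ n - 1)).
    rewrite -(half_scale _ al _ _ _ (pow_gt0 m)) yE addrK.
    by rewrite -(half_scale _ 0 _ _ _ (pow_gt0 n)) !subr0 wE.
  have bm : 3 ^+ n <= 3 ^+ n * (3 ^+ m * b - al).
    by rewrite ler_peMr ?(ltW (pow_gt0 n)) //; rewrite mulrBr in hM; lra.
  rewrite mulrBr in hN.
  by move: hv; rewrite /half; case: s' => /andP[? ?]; apply/andP; split; lra.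
have /exists_pow3_ge[M hM] : 0 < x - a by rewrite subr_gt0.
exists M => m /hM {}hM al /andP[u0 u1].
have bm : 3 ^+ m * x <= 3 ^+ m * b by rewrite ler_pM2l.
have /exists_pow3_ge[N hN] : 0 < 3 ^+ m * b - al by lra.
exists N => n /hN {}hN s' v w y hv wE yE.
have -> : half s' a b y = half s' (3 ^+ n * (3 ^+ m * a - al))
    (3 ^+ n * (3 ^+ m * b - al)) v.
  rewrite -(half_scale _ al _ _ _ (pow_gt0 m)) yE addrK.
  by rewrite -(half_scale _ 0 _ _ _ (pow_gt0 n)) !subr0 wE addr0.
apply: half_sub hv => //.
by rewrite pmulr_rle0 //; rewrite mulrBr in hM; lra.
Qed.

End Half.

(** * The stages of the carpet as iterates of the square *)

Section Carpet.
Variable R : realType.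
Local Notation SQ := (splitSquare R).
Implicit Types (p q r : SQ) (S : set SQ).
Local Notation FS := (hutchinson_set (carpet_ifs R)).

Definition xpos p : R := (split_val p).1.1.
Definition ypos p : R := (split_val p).1.2.
Definition xside p := xright (split_val p).2.
Definition yside p := yright (split_val p).2.

Lemma QboxE (a b c d : R) p : Qbox a b c d p <->
  half (xside p) a b (xpos p) /\ half (yside p) c d (ypos p).
Proof.
rewrite /xside /yside /xpos /ypos; case: p => -[[x y] t] pP /=.
have /QsetE[t4 _ _] := split_valE (SplitSquare pP).
by split=> [/QsetE[]//|[? ?]]; apply/QsetE.
Qed.

Lemma split_unit p :
  half (xside p) 0 1 (xpos p) /\ half (yside p) 0 1 (ypos p).
Proof. exact/QboxE/split_valE. Qed.

Lemma split_pointP s s' (x y : R) : half s 0 1 x -> half s' 0 1 y ->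
  exists p, [/\ xside p = s, xpos p = x, yside p = s' & ypos p = y].
Proof.
move=> hx hy; pose t := (if s then if s' then 4 else 1
                         else if s' then 3 else 2)%N.
have pP : (x, y, t) \in Qset (0 : R) 1 0 1.
  by rewrite inE; apply/QsetE; rewrite /t {t}; case: s hx; case: s' hy.
exists (SplitSquare pP); rewrite /xside /yside /xpos /ypos /=.
by rewrite /t; case: (s); case: (s').
Qed.

Lemma carpet_mapE (i j : 'I_3) p : [/\ xside (carpet_map i j p) = xside p,
  xpos (carpet_map i j p) = (xpos p + i%:R) / 3,
  yside (carpet_map i j p) = yside p &
  ypos (carpet_map i j p) = (ypos p + j%:R) / 3].
Proof. by []. Qed.

Lemma carpet_map_surj p : exists i j q, carpet_map i j q = p.
Proof.
have [/half_digit[i hi] /half_digit[j hj]] := split_unit p.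
exists i, j; move: hi hj; rewrite /xside /yside /xpos /ypos.
case: p => -[[x y] t] /= pP hi hj.
have qP : (3 * x - i%:R, 3 * y - j%:R, t) \in Qset (0 : R) 1 0 1.
  by have /QsetE[t4 _ _] := split_valE (SplitSquare pP); rewrite inE; apply/QsetE.
exists (SplitSquare qP); apply: val_inj => /=.
by rewrite !subrK !(mulrC 3) !mulfK ?pnatr_eq0.
Qed.

Lemma hutchinson_carpetP S p : FS S p <->
  exists i j q, [/\ ~ (i = 1 /\ j = 1), S q & p = carpet_map i j q].
Proof.
split=> [[[[i j] /= ij] _ [q Sq <-]]|[i [j [q [ij Sq ->]]]]].
  by exists i, j, q; split=> // -[i1 j1]; move: ij; rewrite i1 j1 eqxx.
have ij1 : (i, j) != (1, 1).
  by apply/negP; rewrite xpair_eqE => /andP[/eqP ? /eqP ?]; apply: ij.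
by exists (Sub (i, j) ij1) => //; exists q.
Qed.

(** Holes are products, so membership splits into coordinate conditions on digits. *)
Lemma SCstageE k p : SCstage R k p <-> forall n, (n < k)%N ->
  ~ (middle n (xside p) (xpos p) /\ middle n (yside p) (ypos p)).
Proof.
elim: k => [|k IH] /=; first by split=> // _; apply/QboxE; exact: split_unit.
split=> [[/IH Sk hole] n|H].
  rewrite ltnS leq_eqVlt => /predU1P[->|/Sk//] [[l ll hl] [m lm hm]].
  by apply: hole; exists l => //; exists m => //; apply/QboxE.
split; first by apply/IH => n nk; apply: H; exact: ltnW.
case=> l ll [m lm /QboxE[hl hm]].
by apply: (H k) => //; split; [exists l|exists m].
Qed.

(** For an image under the map [(i, j)], the condition at level 0 excludes exactly [(1, 1)], and the
    one at level [n.+1] is that of the preimage at level [n]. *)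
Lemma hutchinson_SCstage k : FS (SCstage R k) = SCstage R k.+1.
Proof.
have E i j q : SCstage R k.+1 (carpet_map i j q) <->
    ~ (i = 1 /\ j = 1) /\ SCstage R k q.
  have [hx hy] := split_unit q.
  rewrite !(propext (SCstageE _ _)); have [-> -> -> ->] := carpet_mapE i j q.
  split=> [H|[ij H]].
    split=> [[i1 j1]|n nk [mx my]].
      by apply: (H 0%N) => //; split; apply/middle0.
    by apply: (H n.+1) => //; split; apply/middleS.
  case=> [_ [/(middle0 _ hx) i1 /(middle0 _ hy) j1]|n nk]; first exact: ij.
  by case=> /(middleS _ _ hx) mx /(middleS _ _ hy) my; apply: (H n).
apply/seteqP; split=> p.
  by move=> /hutchinson_carpetP[i [j [q [ij Sq ->]]]]; apply/E.
have [i [j [q <-]]] := carpet_map_surj p.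
by move=> /E[ij Sq]; apply/hutchinson_carpetP; exists i, j, q.
Qed.

Lemma iter_hutchinson_SCstage k : iter k FS setT = SCstage R k.
Proof.
elim: k => [|k IH]; last by rewrite iterS IH hutchinson_SCstage.
by apply/seteqP; split=> // p _; apply/SCstageE.
Qed.

(** Some composite of [m] maps has [p] in its image; it sends z to (z + (al, be)) / 3^m and keeps
    sides. The last clause applies this composite to any set. *)
Lemma iter_hutchinson_affine m p : iter m FS setT p -> exists al be : R,
  [/\ half (xside p) 0 1 (3 ^+ m * xpos p - al),
      half (yside p) 0 1 (3 ^+ m * ypos p - be) &
      forall S q, S q -> exists2 r, iter m FS S r &
        [/\ xside r = xside q, 3 ^+ m * xpos r = xpos q + al,
            yside r = yside q & 3 ^+ m * ypos r = ypos q + be]].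
Proof.
elim: m p => [|m IH] p.
  exists 0, 0; have [hx hy] := split_unit p.
  rewrite expr0 !mul1r !subr0; split=> // S q Sq.
  by exists q => //; rewrite !mul1r !addr0.
move=> /= /hutchinson_carpetP[i [j [p' [ij /IH[al [be [hx hy H]]] ->]]]].
have [-> -> -> ->] := carpet_mapE i j p'.
exists (al + 3 ^+ m * i%:R), (be + 3 ^+ m * j%:R).
have E (z k : R) : 3 ^+ m.+1 * ((z + k) / 3) = 3 ^+ m * z + 3 ^+ m * k.
  by rewrite exprS; field.
have K (u v w : R) : u + v - (w + v) = u - w by ring.
rewrite !E !K.
split=> // S q /H[r Sr [xs xr ys yr]].
exists (carpet_map i j r); first by apply/hutchinson_carpetP; exists i, j, r.
have [-> -> -> ->] := carpet_mapE i j r.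
by rewrite !E xr yr !addrA.
Qed.

(** One map with digits 0 or 2, hence never the central one, is iterated; the shift is 2 (1 + 3 +
    ... + 3^(n-1)) = 3^n - 1 for digit 2. *)
Lemma iter_hutchinson_corner (s s' : bool) n S q : S q ->
  exists2 r, iter n FS S r &
    [/\ xside r = xside q,
        3 ^+ n * xpos r = xpos q + (if s then 3 ^+ n - 1 else 0),
        yside r = yside q &
        3 ^+ n * ypos r = ypos q + (if s' then 3 ^+ n - 1 else 0)].
Proof.
move=> Sq; elim: n => [|n [r Sr [xs xr ys yr]]].
  by exists q => //; rewrite expr0 !mul1r !subrr !if_same !addr0.
pose c (b : bool) : 'I_3 := if b then 2 else 0.
have cE b : (c b)%:R = (if b then 2 else 0) :> R by case: b.
exists (carpet_map (c s) (c s') r).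
  by apply/hutchinson_carpetP; exists (c s), (c s'), r; split=> // -[]; rewrite /c; case: (s).
have [-> -> -> ->] := carpet_mapE (c s) (c s') r.
have E b (z v : R) : 3 ^+ n * z = v + (if b then 3 ^+ n - 1 else 0) ->
    3 ^+ n.+1 * ((z + (c b)%:R) / 3) = v + (if b then 3 ^+ n.+1 - 1 else 0).
  move=> h; have -> : 3 ^+ n.+1 * ((z + (c b)%:R) / 3) =
    3 ^+ n * z + 3 ^+ n * (c b)%:R by rewrite exprS; field.
  by rewrite h cE exprS; case: b {h}; lra.
by split=> //; exact: E.
Qed.

(** * Compactness of the square, the stages and the carpet *)

Lemma splitSquare_compact : compact [set: SQ].
Proof.
rewrite compact_ultra => F FU _.
have [s [x [hx Fx]]] := ultra_half_cvg FU (fun p => (split_unit p).1).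
have [s' [y [hy Fy]]] := ultra_half_cvg FU (fun p => (split_unit p).2).
(* The labels realise all four pairs of sides, so the two coordinate limits make up a point. *)
have [p [ps px ps' py]] := split_pointP hx hy.
exists p; split=> // A /nbhs_Qbox[[[a b] [c d]] [[[a0 _ b1] [c0 _ d1]]]].
move=> /QboxE; rewrite ps px ps' py => -[pa pc] QA.
apply: filterS (filterI (Fx _ _ a0 b1 pa) (Fy _ _ c0 d1 pc)).
by move=> q [qa qc]; apply/QA/QboxE.
Qed.

Definition full_square (p : SQ) : hyperspace SQ :=
  Hyperspace (ex_intro _ p I : [set: SQ] !=set0) splitSquare_compact.

(** Iterating the operator on nonempty compact sets from the whole square gives nonemptiness and
    compactness of every stage at once. *)
Lemma SCstage_hyperspace k : exists K : hyperspace SQ, K = SCstage R k :> set SQ.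
Proof.
have [p _] : exists p : SQ, True.
  have h : half true (0 : R) 1 0 by rewrite /half lexx ltr01.
  by have [p _] := split_pointP h h; exists p.
exists (iter k (hutchinson (carpet_ifs R)) (full_square p)).
by rewrite iter_hutchinsonE iter_hutchinson_SCstage.
Qed.

Lemma SCstage_closed k : closed (SCstage R k).
Proof.
have [K <-] := SCstage_hyperspace k.
exact: compact_closed (@splitSquare_hausdorff R) (@hset_compact _ K).
Qed.

Lemma SCstage_decreasing :
  {homo SCstage R : m n / (m <= n)%N >-> n `<=` m}.
Proof.
move=> m n mn p /SCstageE H; apply/SCstageE => i im; apply: H.
exact: leq_trans im mn.
Qed.

Lemma splitCarpet_sub_open V : open V -> splitCarpet R `<=` V ->
  exists n, SCstage R n `<=` V.
Proof.
exact: compact_bigcap_sub_open splitSquare_compact SCstage_closed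
  SCstage_decreasing.
Qed.

Lemma splitCarpet_neq0 : splitCarpet R !=set0.
Proof.
apply: contrapT => /nonemptyPn SC0.
(* An empty carpet would force some stage into the empty open set. *)
have [|n Sn] := splitCarpet_sub_open (@open0 SQ); first by rewrite SC0.
have [K KE] := SCstage_hyperspace n.
by have [p] := hset_neq0 K; rewrite KE => /Sn.
Qed.

Lemma splitCarpet_compact : compact (splitCarpet R).
Proof.
apply: (subclosed_compact _ splitSquare_compact) => //.
by apply: closed_bigI => n _; exact: SCstage_closed.
Qed.

(** * Attraction to the carpet *)

Lemma iter_hutchinson_meets V : open V -> splitCarpet R `&` V !=set0 ->
  exists N, forall S, S !=set0 -> iter N FS S `&` V !=set0.
Proof.
move=> oV [p [SCp Vp]].
have /nbhs_Qbox[[[a b] [c d]] [_ /QboxE[hx hy] QV]] : nbhs p V.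
  exact: open_nbhs_nbhs.
have [M1 H1] := half_corner hx; have [M2 H2] := half_corner hy.
pose m := maxn M1 M2; have : iter m FS setT p.
  by rewrite iter_hutchinson_SCstage; exact: SCp.
move=> /iter_hutchinson_affine[al [be [ux uy aff]]].
have [N1 {}H1] := H1 m (leq_maxl _ _) al ux.
have [N2 {}H2] := H2 m (leq_maxr _ _) be uy.
(* First [n] corner steps, then the [m] maps leading into the cell of [p]; neither number depends on
   [S]. *)
pose n := maxn N1 N2; exists (m + n)%N => S [z Sz].
have [q qS [qxs qx qys qy]] := iter_hutchinson_corner (xside p) (yside p) n Sz.
have [r rS [rxs rx rys ry]] := aff _ _ qS.
have [zx zy] := split_unit z.
exists r; split; first by rewrite iterD.
apply: QV; apply/QboxE; rewrite rxs rys qxs qys; split.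
  exact: H1 (leq_maxl _ _) _ _ _ _ zx qx rx.
exact: H2 (leq_maxr _ _) _ _ _ _ zy qy ry.
Qed.

End Carpet.

Theorem theorem4p2 (R : realType) :
  strict_attractor (carpet_ifs R) (splitCarpet R) /\
  full_basin (carpet_ifs R) (splitCarpet R).
Proof.
suff fb : full_basin (carpet_ifs R) (splitCarpet R).
  by split=> //; exact: full_basin_strict_attractor.
exists (Hyperspace (splitCarpet_neq0 R) (@splitCarpet_compact R)) => //.
split=> [|//|K _]; first exact: openT.
apply: vietoris_cvg => V oV /= SCV.
  have [N NV] := splitCarpet_sub_open oV SCV.
  exists N => // n /= Nn; rewrite iter_hutchinsonE => p Kp.
  (* F^n(K) lies in F^n(Q) = SC_n, hence in SC_N. *)
  apply: NV; apply: (SCstage_decreasing Nn); rewrite -iter_hutchinson_SCstage.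
  exact: iter_hutchinson_set_sub Kp.
have [N NV] := iter_hutchinson_meets oV SCV.
(* F^n(K) = F^N(F^(n-N)(K)), and [N] serves every nonempty set. *)
exists N => // n /= Nn; rewrite iter_hutchinsonE -(subnKC Nn) iterD.
by apply: NV; rewrite -iter_hutchinsonE; exact: hset_neq0.
Qed.
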